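(* Let $A$ be an invertible symmetric complex $n\times n$ matrix and $P(z)\in\mathcal{A}_n$ a homogeneous $\Delta_A$-nilpotent polynomial of degree $d\ge3$. Let $\mathcal{I}(P)$ be the ideal of $\mathcal{A}_n$ generated by $\sigma_{A^{-1}}(z):=z^\tau A^{-1}z$ and $\frac{\partial P}{\partial z_i}$ $(1\le i\le n)$. Then, for any $f(z)\in\mathcal{I}(P)$ and $m\ge0$, $$\{f,\Delta_A^mP^{m+1}\}_A=f(AD)\,\Delta_A^mP^{m+1}=0.$$
   Context: $\mathcal{A}_n=\mathbb{C}[z_1,\dots,z_n]$, $z=(z_1,\dots,z_n)$, $D=(D_1,\dots,D_n)$ with $D_i=\partial/\partial z_i$, $\Delta_A=\sum_{i,j=1}^n a_{ij}D_iD_j$ for $A=(a_{ij})$. $P$ is $\Delta_A$-nilpotent if $\Delta_A^m(P^m)=0$ for all $m\ge1$. The $\mathbb{C}$-bilinear map $\{\cdot,\cdot\}_A:\mathcal{A}_n\times\mathcal{A}_n\to\mathcal{A}_n$ is $\{f,g\}_A:=f(AD)g(z)$, where $f(AD)$ is the constant coefficient differential operator obtained by substituting $\sum_{j}a_{ij}D_j$ for $z_i$ in $f$. $\Delta_A^mP^{m+1}$ means $\Delta_A^m$ applied to $P^{m+1}$. *)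

(* Defs.v *)
From HB Require Import structures.
From mathcomp Require Import all_boot all_order all_algebra.
From mathcomp Require Import reals.
From mathcomp Require Import complex.
From mathcomp Require Import mpoly.

Set Implicit Arguments.
Unset Strict Implicit.
Unset Printing Implicit Defensive.

Import GRing.Theory.
Local Open Scope ring_scope.

Section Defs.
Context {K : fieldType} {n : nat}.
Implicit Types (A : 'M[K]_n) (f g P : {mpoly K[n]}).

Definition Laplacian A P : {mpoly K[n]} :=
  \sum_(i < n) \sum_(j < n) A i j *: P^`M(j)^`M(i).

Definition Laplacian_nilpotent A P : Prop :=
  forall m : nat, (0 < m)%N -> iter m (Laplacian A) (P ^+ m) = 0.

(* [diffop f g] is f(D) g: the variable 'X_i of f acts on g as the partial
   derivative D_i. *)
Definition diffop f g : {mpoly K[n]} :=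
  \sum_(m <- msupp f) f@_m *: g^`M[m].

(* {f, g}_A = f(AD) g, where f(AD) is h(D) for the polynomial h(z) = f(Az). *)
Definition bracket A f g : {mpoly K[n]} :=
  diffop (f \mPo [tuple \sum_(j < n) A i j *: 'X_j | i < n]) g.

(* The quadratic form z^T B z. *)
Definition sigma (B : 'M[K]_n) : {mpoly K[n]} :=
  \sum_(i < n) \sum_(j < n) B i j *: ('X_i * 'X_j).

End Defs.

Definition generated_ideal (S : comNzRingType) (gs : seq S) (f : S) : Prop :=
  exists c : 'I_(size gs) -> S, f = \sum_(k < size gs) c k * gs`_k.

Definition ideal_of (K : fieldType) (n : nat) (A : 'M[K]_n)
    (P : {mpoly K[n]}) : {mpoly K[n]} -> Prop :=
  generated_ideal (sigma (invmx A) :: [seq P^`M(i) | i <- enum 'I_n]).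

(* Main.v *)
(* Since [Delta^N (z_i h) = z_i Delta^N h + 2 N (AD)_i Delta^(N-1) h], a
   homogeneous [f] of degree [e] and a [g] killed by [Delta^(m+1)] satisfy
   [Delta^(m+e) (f g) = 2^e (m+e)!/m! f(AD) Delta^m g]. For [f = P_i],
   [g = P^(m+1)] and [e = d - 1 >= 2], the left-hand side is
   [1/(m+2) D_i Delta^(m+e) P^(m+2)], which vanishes by nilpotency. The other
   generator is immediate: [sigma_(A^-1)(AD) = Delta], and [f |-> f(AD)] is
   multiplicative. *)
Require Import Defs.
From HB Require Import structures.
From mathcomp Require Import all_boot all_order all_algebra.
From mathcomp Require Import reals.
From mathcomp Require Import complex.
From mathcomp Require Import ssrcomplements mpoly.

Set Implicit Arguments.
Unset Strict Implicit.
Unset Printing Implicit Defensive.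

Import GRing.Theory.
Local Open Scope ring_scope.

Section ConstantCoefficientOperators.
Context {K : fieldType} {n : nat}.
Implicit Types (A : 'M[K]_n) (f g h P : {mpoly K[n]}).

(** The support varies with [f]; a degree window that contains it gives several polynomials a common
    index set, so linearity in [f] can be read off coefficientwise. *)
Lemma diffopwE k f g : (msize f <= k)%N ->
  diffop f g = \sum_(m : 'X_{1..n < k}) f@_m *: g^`M[m].
Proof.
move=> le_fk; rewrite /diffop (big_mksub 'X_{1..n < k}) //=; first last.
- by move=> m /msize_mdeg_lt lt_m; apply: leq_trans lt_m le_fk.
- exact: msupp_uniq.
by rewrite big_rmcond //= => m /memN_msupp_eq0 ->; rewrite scale0r.
Qed.

Lemma diffop_linearl g : linear (diffop^~ g).
Proof.
move=> c f h /=; pose k := maxn (msize (c *: f + h)) (maxn (msize f) (msize h)).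
rewrite !(@diffopwE k) ?leq_max ?leqnn ?orbT // scaler_sumr -big_split /=.
by apply: eq_bigr => m _; rewrite mcoeffD mcoeffZ scalerDl scalerA.
Qed.

Lemma diffop0l g : diffop 0 g = 0.
Proof. by rewrite /diffop msupp0 big_nil. Qed.

Lemma diffopZl c f g : diffop (c *: f) g = c *: diffop f g.
Proof. by rewrite -[c *: f]addr0 diffop_linearl diffop0l addr0. Qed.

Lemma diffop_suml I (r : seq I) (Q : pred I) F g :
  diffop (\sum_(x <- r | Q x) F x) g = \sum_(x <- r | Q x) diffop (F x) g.
Proof.
apply: (big_morph (diffop^~ g) _ (diffop0l g)) => f h.
by rewrite -[f in LHS]scale1r diffop_linearl scale1r.
Qed.

Lemma diffopX m g : diffop 'X_[m] g = g^`M[m].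
Proof. by rewrite /diffop msuppX big_seq1 mcoeffX eqxx scale1r. Qed.

Lemma diffop_linearr f : linear (diffop f).
Proof.
move=> c g h; rewrite /diffop scaler_sumr -big_split /=.
by apply: eq_bigr => m _; rewrite linearP scalerDr !scalerA mulrC.
Qed.

HB.instance Definition _ f :=
  GRing.isLinear.Build K {mpoly K[n]} {mpoly K[n]} _ (diffop f)
    (diffop_linearr f).

Lemma diffopM f h g : diffop (f * h) g = diffop f (diffop h g).
Proof.
rewrite [f]mpolyE mulr_suml !diffop_suml /=.
apply: eq_bigr => a _; rewrite -scalerAl !diffopZl /= diffopX.
congr (_ *: _); rewrite [h]mpolyE mulr_sumr !diffop_suml linear_sum /=.
apply: eq_bigr => b _; rewrite -scalerAr !diffopZl linearZ /=.
by rewrite -mpolyXD !diffopX addmC mderivmDm.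
Qed.

Lemma bracketZl A c f g : bracket A (c *: f) g = c *: bracket A f g.
Proof. by rewrite /bracket linearZ diffopZl. Qed.

Lemma bracket_suml A I (r : seq I) (Q : pred I) F g :
  bracket A (\sum_(x <- r | Q x) F x) g = \sum_(x <- r | Q x) bracket A (F x) g.
Proof. by rewrite /bracket linear_sum diffop_suml. Qed.

HB.instance Definition _ A f := GRing.Linear.copy (bracket A f)
  (diffop (f \mPo [tuple \sum_(j < n) A i j *: 'X_j | i < n])).

Lemma bracketM A f h g : bracket A (f * h) g = bracket A f (bracket A h g).
Proof. by rewrite /bracket rmorphM diffopM. Qed.

Lemma bracketXU A i g : bracket A 'X_i g = \sum_(j < n) A i j *: g^`M(j).
Proof.
rewrite /bracket comp_mpolyXU -tnth_nth tnth_mktuple diffop_suml.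
by apply: eq_bigr => j _; rewrite diffopZl /= diffopX mderivmU1m.
Qed.

Lemma bracket1 A g : bracket A 1 g = g.
Proof. by rewrite /bracket comp_mpoly1 -mpolyX0 diffopX mderivm0m. Qed.

Lemma Laplacian_linear A : linear (Laplacian A).
Proof.
move=> c f h; rewrite /Laplacian scaler_sumr -big_split /=.
apply: eq_bigr => i _; rewrite scaler_sumr -big_split /=.
by apply: eq_bigr => j _; rewrite !(mderivD, mderivZ) scalerDr !scalerA mulrC.
Qed.

HB.instance Definition _ A :=
  GRing.isLinear.Build K {mpoly K[n]} {mpoly K[n]} _ (Laplacian A)
    (Laplacian_linear A).

Lemma iter_Laplacian_linear A k : linear (iter k (Laplacian A)).
Proof. by move=> c f h; elim: k => //= k ->; rewrite linearP. Qed.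

HB.instance Definition _ A k :=
  GRing.isLinear.Build K {mpoly K[n]} {mpoly K[n]} _ (iter k (Laplacian A))
    (iter_Laplacian_linear A k).

(** The divergence form of the operator: the Leibniz rule can then be applied to one first-order
    operator at a time. *)
Lemma LaplacianE A g : Laplacian A g = \sum_(i < n) (bracket A 'X_i g)^`M(i).
Proof.
apply: eq_bigr => i _; rewrite bracketXU linear_sum.
by apply: eq_bigr => j _; rewrite linearZ.
Qed.

Lemma mderiv_Laplacian A i g : (Laplacian A g)^`M(i) = Laplacian A g^`M(i).
Proof.
rewrite /Laplacian linear_sum; apply: eq_bigr => j _.
rewrite linear_sum; apply: eq_bigr => k _ /=.
by rewrite mderivZ mderiv_comm (mderiv_comm _ i).
Qed.

Lemma mderiv_iter_Laplacian A k i g :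
  (iter k (Laplacian A) g)^`M(i) = iter k (Laplacian A) g^`M(i).
Proof. by elim: k => //= k IHk; rewrite mderiv_Laplacian IHk. Qed.

Lemma bracketXU_Laplacian A i g :
  bracket A 'X_i (Laplacian A g) = Laplacian A (bracket A 'X_i g).
Proof.
rewrite !bracketXU linear_sum; apply: eq_bigr => j _.
by rewrite linearZ mderiv_Laplacian.
Qed.

Lemma mderivXU i j : ('X_i : {mpoly K[n]})^`M(j) = (i == j)%:R.
Proof.
rewrite mderivX mnm1E; case: eqP => [->|_]; last by rewrite scale0r.
by rewrite scale1r -[U_(j)%MM in X in (X - _)%MM]add0m addmK mpolyX0.
Qed.

(* Symmetry of [A] merges the two cross terms of the Leibniz rule. *)
Lemma LaplacianXM A i g : A^T = A ->
  Laplacian A ('X_i * g) = 'X_i * Laplacian A g + bracket A 'X_i g *+ 2.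
Proof.
move=> A_sym; have symA j k : A j k = A k j by rewrite -{1}A_sym mxE.
have D_XM j : ('X_i * g)^`M(j) = (i == j)%:R * g + 'X_i * g^`M(j).
  by rewrite mderivM mderivXU.
have V_XM j : bracket A 'X_j ('X_i * g)
    = A i j *: g + 'X_i * bracket A 'X_j g.
  rewrite !bracketXU; under eq_bigr do rewrite D_XM scalerDr.
  rewrite big_split /= (bigD1 i) //= big1 => [|k /negPf ik]; last first.
    by rewrite eq_sym ik mul0r scaler0.
  rewrite eqxx mul1r addr0 symA mulr_sumr; congr (_ + _).
  by apply: eq_bigr => k _; rewrite scalerAr.
rewrite !LaplacianE.
under eq_bigr do rewrite V_XM mderivD mderivZ mderivM mderivXU.
rewrite !big_split /= -bracketXU addrA addrC mulr_sumr mulr2n.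
congr (_ + (_ + _)).
rewrite (bigD1 i) //= big1 => [|k /negPf ik]; last by rewrite eq_sym ik mul0r.
by rewrite eqxx mul1r addr0.
Qed.

(** Each Laplacian moved past ['X_i] leaves one term [2 (AD)_i]. Since [(AD)_i] commutes with the
    Laplacian, the [k.+1] such terms coincide. *)
Lemma iter_LaplacianXM A i k g : A^T = A ->
  iter k.+1 (Laplacian A) ('X_i * g) = 'X_i * iter k.+1 (Laplacian A) g
    + bracket A 'X_i (iter k (Laplacian A) g) *+ (k.+1 * 2).
Proof.
move=> A_sym; elim: k => [|k IHk]; first by rewrite /= LaplacianXM.
rewrite iterS IHk linearD /= LaplacianXM // linearMn /= -bracketXU_Laplacian.
by rewrite -addrA -mulrnDr.
Qed.

Lemma mderiv_dhomog e i P : P \is e.+1.-homog -> P^`M(i) \is e.-homog.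
Proof.
move=> /dhomogP homP; apply/dhomogP => m.
rewrite mcoeff_msupp mcoeff_deriv => nz.
suff /homP : (m + U_(i))%MM \in msupp P.
  by rewrite /= mdegD mdeg1 addn1 => -[].
by rewrite mcoeff_msupp; apply: contraNneq nz => ->; rewrite mul0rn.
Qed.

(* Each variable of [f] must absorb one of the [m + e] Laplacians, since more
   than [m] of them annihilate [g]. *)
Lemma iter_Laplacian_dhomogM A m e f g : A^T = A -> f \is e.-homog ->
    iter m.+1 (Laplacian A) g = 0 ->
  iter (m + e) (Laplacian A) (f * g)
    = bracket A f (iter m (Laplacian A) g) *+ ((m + e) ^_ e * 2 ^ e).
Proof.
move=> A_sym /dhomogP homf g0; rewrite [f]mpolyE mulr_suml linear_sum /=.
rewrite bracket_suml -sumrMnl big_seq [RHS]big_seq.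
apply: eq_bigr => a /homf /=; rewrite -scalerAl linearZ /=.
rewrite bracketZl scalerMnr => deg_a; congr (_ *: _).
(* [m] stays general because the induction hypothesis is needed at both [m] and [m.+1]. *)
elim: e a deg_a m g0 {homf} => [|e IHe] a deg_a m g0.
  move/eqP: deg_a; rewrite mdeg_eq0 => /eqP->.
  by rewrite mpolyX0 bracket1 mul1r addn0.
have [i ai] : exists i, (0 < a i)%N.
  apply/existsP; apply: contraPT deg_a; rewrite negb_exists => /forallP a0.
  by rewrite mdegE big1 // => i _; apply/eqP; rewrite -leqn0 leqNgt.
have Ea : a = (U_(i) + (a - U_(i)))%MM by rewrite addmC submK // lep1mP -lt0n.
move: deg_a; rewrite {}Ea mdegD mdeg1 add1n => -[deg_b].
set b := (a - _)%MM in deg_b *; rewrite mpolyXD -mulrA addnS.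
(* The derivative term is the hypothesis at [m]. In the term that keeps ['X_i] outside, the
   hypothesis at [m.+1] produces [Delta^(m+1) g = 0]. *)
rewrite iter_LaplacianXM // (IHe _ deg_b _ g0) bracketM -addSn.
rewrite (IHe _ deg_b m.+1) ?g0; last by rewrite iterS g0 linear0.
rewrite linear0 mul0rn mulr0 add0r linearMn /= -mulrnA; congr (_ *+ _).
by rewrite addSn ffactnS expnS mulnACA (mulnC _.+1) (mulnC 2%N).
Qed.

(** In [(AD)^T A^-1 (AD)] the inverse cancels one factor [A], leaving the sum of the
    [(AD)_i D_i]. *)
Lemma bracket_sigma A g :
  A \in unitmx -> bracket A (sigma (invmx A)) g = Laplacian A g.
Proof.
move=> uA; rewrite /sigma bracket_suml /=.
(* This is [D = A^-1 (AD)]: after exchanging sums, the coefficient of [D_k] is the entry [(i, k)] of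
   [A^-1 A]. *)
have DE i : g^`M(i) = \sum_(j < n) invmx A i j *: bracket A 'X_j g.
  under eq_bigr do rewrite bracketXU scaler_sumr.
  rewrite exchange_big /= (bigD1 i) //= [X in _ + X]big1 => [|k /negPf ki].
    under eq_bigr do rewrite scalerA.
    rewrite -scaler_suml; have /matrixP/(_ i i) := mulVmx uA.
    by rewrite !mxE eqxx => ->; rewrite scale1r addr0.
  under eq_bigr do rewrite scalerA.
  rewrite -scaler_suml; have /matrixP/(_ i k) := mulVmx uA.
  by rewrite !mxE eq_sym ki => ->; rewrite scale0r.
rewrite LaplacianE; apply: eq_bigr => i _.
transitivity (bracket A 'X_i g^`M(i)).
  rewrite [in RHS]DE linear_sum bracket_suml /=.
  apply: eq_bigr => j _.
  by rewrite linearZ bracketZl /= bracketM.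
rewrite !bracketXU linear_sum; apply: eq_bigr => j _ /=.
by rewrite mderivZ mderiv_comm.
Qed.

Lemma mderiv_exp i k P : (P ^+ k.+1)^`M(i) = (P^`M(i) * P ^+ k) *+ k.+1.
Proof.
elim: k => [|k IHk]; first by rewrite !expr1 expr0 mulr1.
by rewrite exprS mderivM IHk mulrnAr mulrCA -exprS -mulrS.
Qed.

Lemma bracket_mderiv_iter_Laplacian A d P m i : [pchar K] =i pred0 ->
    A^T = A -> (3 <= d)%N -> P \is d.-homog -> Laplacian_nilpotent A P ->
  bracket A P^`M(i) (iter m (Laplacian A) (P ^+ m.+1)) = 0.
Proof.
move=> /pcharf0P char0 A_sym; case: d => // e e_ge2 homP nilP.
(* The multiple [m.+2] turns [P_i P^(m+1)] into the derivative of [P^(m+2)], avoiding a division. *)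
have /eqP: iter (m + e) (Laplacian A) (P^`M(i) * P ^+ m.+1) *+ m.+2 = 0.
  rewrite -(raddfMn (iter (m + e) (Laplacian A))) -mderiv_exp /=.
  (* As [e >= 2], the [m + e] Laplacians split into [m + 2], which already annihilate [P^(m+2)], and
     [e - 2] more. *)
  rewrite -mderiv_iter_Laplacian -(subnKC (e_ge2 : 1 < e)%N) addnA addn2 addnC.
  by rewrite iterD nilP // linear0 mderiv0.
rewrite (iter_Laplacian_dhomogM A_sym (mderiv_dhomog i homP)) ?nilP //.
(* In characteristic zero the factor [(m+2) (m+e)^_e 2^e] is nonzero, so the bracket itself
   vanishes. *)
rewrite -mulrnA -scaler_nat scaler_eq0 char0 !muln_eq0 expn_eq0 /=.
by rewrite orbF -leqn0 leqNgt ffact_gt0 leq_addl => /eqP.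
Qed.

End ConstantCoefficientOperators.

Theorem theorem4p10 (R : realType) (n d : nat) (A : 'M[R[i]]_n)
    (P : {mpoly R[i][n]})
    (A_unit : A \in unitmx) (A_sym : A^T = A)
    (d_ge3 : (3 <= d)%N) (P_homog : P \is d.-homog)
    (P_nilp : Laplacian_nilpotent A P)
    (f : {mpoly R[i][n]}) (f_ideal : ideal_of A P f) (m : nat) :
  bracket A f (iter m (Laplacian A) (P ^+ m.+1)) = 0.
Proof.
have [c ->] := f_ideal; rewrite bracket_suml big1 //= => k _.
(* The coefficient [c k] acts after the generator, so it suffices that each generator
   annihilates. *)
rewrite bracketM; set h := nth _ _ _; suff -> : bracket A h
  (iter m (Laplacian A) (P ^+ m.+1)) = 0 by rewrite linear0.
have : h \in sigma (invmx A) :: [seq P^`M(i) | i <- enum 'I_n].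
  exact: mem_nth.
rewrite inE => /orP[/eqP-> | /mapP[i _ ->]].
  by rewrite bracket_sigma // -iterS P_nilp.
exact: bracket_mderiv_iter_Laplacian
  (Num.Theory.pchar_num _) A_sym d_ge3 P_homog P_nilp.
Qed.
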